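(* Let $p\ge 2$, $r\in(0,1)$, $a=1/p$ and $\pi_p=2\pi/(p\sin(\pi/p))$. Then $$\frac{\pi}{2}\left(\frac{\mathrm{artanh}_p(r)}{r}\right)^{1/2}<\frac{\pi}{2}\left(1-\frac{p-1}{p^2}\log(1-r^2)\right)<\mathcal{K}_a(r)<\frac{\pi}{2}\left(1-\frac{2}{p\,\pi_p}\log(1-r^2)\right).$$
   Context: $F(a,b;c;z)=\sum_{n=0}^\infty \frac{(a,n)(b,n)}{(c,n)}\frac{z^n}{n!}$ for $|z|<1$ is the Gaussian hypergeometric function, where $(a,0)=1$ and $(a,n)=a(a+1)\cdots(a+n-1)$ for $n\ge 1$. For $a\in(0,1/2]$ and $r\in(0,1)$, $\mathcal{K}_a(r)=\frac{\pi}{2}F(a,1-a;1;r^2)$. For $p>1$ and $x\in(0,1)$, $\mathrm{artanh}_p(x)=\int_0^x(1-t^p)^{-1}\,dt=xF\left(1,\frac1p;1+\frac1p;x^p\right)$. Here $p$ is a real number. *)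

(* Defs.v *)
From Stdlib Require Import Reals Factorial.
From Coquelicot Require Import Coquelicot.

Open Scope R_scope.

(** Shifted factorial (a,n) = a (a+1) ... (a+n-1), with (a,0) = 1. *)
Fixpoint poch (a : R) (n : nat) : R :=
  match n with
  | O => 1
  | S m => poch a m * (a + INR m)
  end.

(** Gaussian hypergeometric function F(a,b;c;z), meant for |z| < 1 and c not in
    {0, -1, -2, ...}; [PSeries u z] is the sum of [u n * z ^ n]. *)
Definition hyp2F1 (a b c z : R) : R :=
  PSeries (fun n => poch a n * poch b n / (poch c n * INR (fact n))) z.

(** The argument [r] is the modulus: the series is evaluated at r^2. *)
Definition ellK (a r : R) : R := PI / 2 * hyp2F1 a (1 - a) 1 (r ^ 2).

(** [Rpower t p] is t^p for t > 0 only ([Rpower 0 p] is not 0).  The integrand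
    is thus off at the single endpoint t = 0, which changes neither the
    integrability nor the value of the Riemann integral. *)
Definition artanh_p (p x : R) : R := RInt (fun t => / (1 - Rpower t p)) 0 x.

Definition pi_p (p : R) : R := 2 * PI / (p * sin (PI / p)).

(* Main.v *)
Require Import Defs.
From Stdlib Require Import Reals Factorial Lra Lia.
From Coquelicot Require Import Coquelicot.

(** With [x = r ^ 2], [c = a (1 - a) = (p - 1) / p ^ 2] and [A_n] the Taylor
    coefficients of the hypergeometric function, [ellK a r] is [PI / 2] times
    the sum of the [A_n x ^ n], whereas [1 - k ln (1 - x)] is one plus the sum
    of the [k x ^ n / n].  The two bounds of [ellK] therefore compare [n A_n]
    with a constant.

    The recurrence [(n + 1) ^ 2 A_(n+1) = (n ^ 2 + n + c) A_n] makes [n A_n]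
    strictly increasing from [A_1 = c] ([scaled_ellCoeff_S_lt]), which gives the
    lower bound.  The limit of [n A_n] is [sin (PI a) / PI = 2 / (p pi_p)], by
    Euler's product for the sine.  Only an upper bound for every [n] is wanted,
    and it follows without a limit from the integrals [cosInt a m] of
    [cos (2 a t) cos t ^ (2 m)] over a quarter period: integration by parts
    gives them a recursion which, relative to [cosInt 0 m], is inverse to that of
    [(a + m) A_m]; hence the exact identity
    [(a + m) A_m cosInt a m = cosInt 0 m sin (PI a) / PI] ([ellCoeff_cosInt]),
    while [cos (2 a t) >= 1 - 2 a sin t ^ 2] bounds [cosInt a m / cosInt 0 m]
    below by [1 - a / (m + 1)].  These combine to
    [n A_n <= sin (PI a) / PI] ([scaled_ellCoeff_le]), and strict monotonicity
    makes the inequality strict.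

    For the square root, put [L = - ln (1 - r ^ 2)].  Since
    [1 + 2 c L < (1 + c L) ^ 2], it is enough that
    [artanh_p p r <= r (1 + 2 c L)] ([artanh_p_le]); this inequality holds
    between the derivatives in [r], by Bernoulli's inequality for the exponent
    [p / 2] ([inv_one_minus_Rpower_le]). *)

Open Scope R_scope.

(** * Power series of the logarithm and termwise comparison *)

Lemma CV_radius_one : CV_radius (fun _ => 1) = 1.
Proof.
  replace (Finite 1) with (Finite (/ 1)) by (f_equal; field).
  apply CV_radius_finite_DAlembert; [intros; lra | lra |].
  apply is_lim_seq_ext with (fun _ => 1); [|apply is_lim_seq_const].
  intros _; replace (1 / 1) with 1 by field; now rewrite Rabs_R1.
Qed.

Lemma is_RInt_inv_one_minus (x : R) :
  0 < x < 1 -> is_RInt (fun t => / (1 - t)) 0 x (- ln (1 - x)).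
Proof.
  intros hx.
  replace (- ln (1 - x)) with (minus (- ln (1 - x)) (- ln (1 - 0)))
    by (unfold minus, plus, opp; simpl; rewrite Rminus_0_r, ln_1; ring).
  apply (is_RInt_derive (fun t => - ln (1 - t))); rewrite Rmin_left, Rmax_right by lra;
    intros t ht.
  - auto_derive; [lra | field; lra].
  - apply (ex_derive_continuous (fun t => / (1 - t))); auto_derive; lra.
Qed.

(** Integrating the geometric series termwise. *)
Lemma is_pseries_log (x : R) :
  0 < x < 1 -> is_pseries (PS_Int (fun _ => 1)) x (- ln (1 - x)).
Proof.
  intros hx.
  replace (- ln (1 - x)) with (RInt (PSeries (fun _ => 1)) 0 x).
  { apply is_pseries_RInt; rewrite CV_radius_one; simpl; rewrite Rabs_pos_eq; lra. }
  rewrite <- (is_RInt_unique _ _ _ _ (is_RInt_inv_one_minus x hx)).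
  apply RInt_ext; rewrite Rmin_left, Rmax_right by lra; intros t ht.
  apply is_pseries_unique, is_pseries_R.
  apply is_series_ext with (fun n => t ^ n); [intros n; symmetry; apply Rmult_1_l|].
  apply is_series_geom; rewrite Rabs_pos_eq; lra.
Qed.

(** Taylor coefficients of [1 - k ln (1 - x)]. *)
Definition logCoeff (k : R) (n : nat) : R :=
  match n with O => 1 | S m => k / INR (S m) end.

Lemma is_series_logCoeff (k x : R) :
  0 < x < 1 -> is_series (fun n => logCoeff k n * x ^ n) (1 - k * ln (1 - x)).
Proof.
  intros hx.
  pose proof (is_pseries_log x hx) as H; apply is_pseries_R in H.
  apply (is_series_scal_l k) in H.
  apply is_series_decr_1.
  apply is_series_ext with
    (fun n => scal k (PS_Int (fun _ => 1) (S n) * x ^ S n)).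
  { intros n; unfold scal; simpl; unfold mult; cbn -[INR pow].
    unfold logCoeff, Rdiv; ring. }
  apply (is_series_incr_1 (fun n => scal k (PS_Int (fun _ => 1) n * x ^ n))).
  replace (plus (plus _ _) _) with (scal k (- ln (1 - x))); [exact H|].
  unfold plus, opp, scal; simpl; unfold mult; simpl; ring.
Qed.

Lemma Series_lt (u v : nat -> R) (N : nat) :
  (forall n, 0 <= u n <= v n) -> u N < v N -> ex_series v -> Series u < Series v.
Proof.
  revert u v; induction N as [|N IH]; intros u v huv hN hv;
    (assert (hu : ex_series u);
      [ apply (ex_series_le u v); [|exact hv];
        intros n; unfold norm; simpl; unfold abs; simpl;
        rewrite Rabs_pos_eq; apply huv |]);
    rewrite (Series_incr_1 u hu), (Series_incr_1 v hv);
    apply -> (ex_series_incr_1 v) in hv.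
  - apply Rplus_lt_le_compat; [exact hN|].
    apply Series_le; [intros n; apply huv | exact hv].
  - apply Rplus_le_lt_compat; [apply huv|].
    apply IH; [intros n; apply huv | exact hN | exact hv].
Qed.

(** * Coefficients of the complete elliptic integral *)

Definition ellCoeff (a : R) (n : nat) : R :=
  poch a n * poch (1 - a) n / (poch 1 n * INR (fact n)).

Lemma poch_one (n : nat) : poch 1 n = INR (fact n).
Proof.
  induction n as [|n IH]; [reflexivity|].
  rewrite fact_simpl, mult_INR, S_INR, <- IH; simpl; ring.
Qed.

Lemma ellCoeff_S (a : R) (n : nat) :
  INR (S n) ^ 2 * ellCoeff a (S n) = (a + INR n) * (1 - a + INR n) * ellCoeff a n.
Proof.
  unfold ellCoeff; rewrite !poch_one, fact_simpl, mult_INR; cbn [poch].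
  field; split; [apply INR_fact_neq_0 | apply not_0_INR; lia].
Qed.

(** With [A_n = ellCoeff a n], the sequence [n A_n] grows by the factor
    [1 + a (1 - a) / (n (n + 1))]. *)
Lemma scaled_ellCoeff_lt (a : R) (n : nat) :
  0 < a < 1 -> 0 < INR (S n) * ellCoeff a (S n) ->
  INR (S n) * ellCoeff a (S n) < INR (S (S n)) * ellCoeff a (S (S n)).
Proof.
  intros ha hpos.
  pose proof (ellCoeff_S a (S n)) as H.
  rewrite (S_INR (S n)) in *.
  assert (hm : 0 < INR (S n)) by (apply lt_0_INR; lia).
  set (m := INR (S n)) in *; set (A := ellCoeff a (S n)) in *;
    set (A' := ellCoeff a (S (S n))) in *.
  assert (hA : 0 < A) by nra.
  apply Rmult_lt_reg_l with (m + 1); [lra|].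
  replace ((m + 1) * ((m + 1) * A')) with ((a + m) * (1 - a + m) * A) by (rewrite <- H; ring).
  apply Rlt_0_minus.
  replace ((a + m) * (1 - a + m) * A - (m + 1) * (m * A)) with (a * (1 - a) * A) by ring.
  apply Rmult_lt_0_compat; [nra | exact hA].
Qed.

Lemma ellCoeff_one (a : R) : ellCoeff a 1 = a * (1 - a).
Proof. unfold ellCoeff; simpl; field. Qed.

Lemma scaled_ellCoeff_ge (a : R) (n : nat) :
  0 < a < 1 -> a * (1 - a) <= INR (S n) * ellCoeff a (S n).
Proof.
  intros ha; induction n as [|n IH].
  - rewrite ellCoeff_one; simpl; lra.
  - pose proof (scaled_ellCoeff_lt a n ha); nra.
Qed.

Lemma ellCoeff_pos (a : R) (n : nat) : 0 < a < 1 -> 0 < ellCoeff a n.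
Proof.
  intros ha; destruct n as [|n]; [unfold ellCoeff; simpl; lra|].
  pose proof (scaled_ellCoeff_ge a n ha).
  assert (0 < INR (S n)) by (apply lt_0_INR; lia).
  assert (0 < a * (1 - a)) by nra.
  nra.
Qed.

Lemma scaled_ellCoeff_S_lt (a : R) (n : nat) :
  0 < a < 1 ->
  INR (S n) * ellCoeff a (S n) < INR (S (S n)) * ellCoeff a (S (S n)).
Proof.
  intros ha; apply scaled_ellCoeff_lt; [exact ha|].
  apply Rmult_lt_0_compat; [apply lt_0_INR; lia | now apply ellCoeff_pos].
Qed.

(** * The cosine integrals bounding the scaled coefficients *)

Definition cosInt (a : R) (m : nat) : R :=
  RInt (fun t => cos (2 * a * t) * cos t ^ (2 * m)) 0 (PI / 2).

Lemma ex_RInt_cosInt (a : R) (m : nat) :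
  ex_RInt (fun t => cos (2 * a * t) * cos t ^ (2 * m)) 0 (PI / 2).
Proof.
  apply (@ex_RInt_continuous R_CompleteNormedModule); intros t _.
  apply (ex_derive_continuous (fun t => cos (2 * a * t) * cos t ^ (2 * m))).
  auto_derive; trivial.
Qed.

(** Two integrations by parts, packed into one antiderivative that vanishes at
    both endpoints. *)
Lemma cosInt_S (a : R) (m : nat) :
  (INR m + 1) * (2 * INR m + 1) * cosInt a m
  = 2 * ((INR m + 1) ^ 2 - a ^ 2) * cosInt a (S m).
Proof.
  unfold cosInt; replace (2 * S m)%nat with (2 * m + 2)%nat by lia.
  assert (hk : 2 * INR m = INR (2 * m)) by (rewrite mult_INR; simpl; ring).
  pose proof (ex_RInt_cosInt a m) as E0; pose proof (ex_RInt_cosInt a (S m)) as E1.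
  replace (2 * S m)%nat with (2 * m + 2)%nat in E1 by lia.
  revert hk E0 E1; generalize (2 * m)%nat as k; intros k hk E0 E1.
  set (n := 2 * INR m + 2).
  pose (G := fun t => n * sin t * cos t ^ (k + 1) * cos (2 * a * t)
                      - 2 * a * cos t ^ (k + 2) * sin (2 * a * t)).
  pose (g := fun t => (n ^ 2 - 4 * a ^ 2) * (cos (2 * a * t) * cos t ^ (k + 2))
                      - n * (n - 1) * (cos (2 * a * t) * cos t ^ k)).
  assert (HG : is_RInt g 0 (PI / 2) (minus (G (PI / 2)) (G 0))).
  { apply (is_RInt_derive G g); intros t _.
    - unfold G, g; auto_derive; [trivial|].
      replace (INR (k + 1)) with (n - 1) by (unfold n; rewrite plus_INR; simpl; lra).
      replace (INR (k + 2)) with n by (unfold n; rewrite plus_INR; simpl; lra).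
      replace (Init.Nat.pred (k + 1)) with k by lia.
      replace (Init.Nat.pred (k + 2)) with (k + 1)%nat by lia.
      rewrite !pow_add.
      pose proof (sin2_cos2 t) as H; unfold Rsqr in H.
      assert (Hc : sin t * sin t = 1 - cos t * cos t) by lra.
      ring [Hc].
    - apply (ex_derive_continuous g); unfold g; auto_derive; trivial. }
  assert (HL : is_RInt g 0 (PI / 2)
     (minus
        (scal (n ^ 2 - 4 * a ^ 2)
          (RInt (fun t => cos (2 * a * t) * cos t ^ (k + 2)) 0 (PI / 2)))
        (scal (n * (n - 1)) (RInt (fun t => cos (2 * a * t) * cos t ^ k) 0 (PI / 2))))).
  { apply (@is_RInt_minus R_NormedModule); apply (@is_RInt_scal R_NormedModule);
      apply (@RInt_correct R_CompleteNormedModule); assumption. }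
  apply (@is_RInt_unique R_CompleteNormedModule) in HG.
  apply (@is_RInt_unique R_CompleteNormedModule) in HL; rewrite HG in HL.
  assert (G0 : G 0 = 0) by (unfold G; rewrite Rmult_0_r, sin_0; ring).
  assert (G1 : G (PI / 2) = 0)
    by (unfold G; rewrite cos_PI2, !pow_ne_zero by lia; ring).
  rewrite G0, G1 in HL.
  unfold minus, plus, opp, scal in HL; simpl in HL; unfold mult in HL; simpl in HL.
  unfold n in HL; lra.
Qed.

Lemma cosInt_0 (a : R) : 0 < a -> 2 * a * cosInt a 0 = sin (PI * a).
Proof.
  intros ha.
  assert (H : is_RInt (fun t => cos (2 * a * t) * cos t ^ (2 * 0)) 0 (PI / 2)
     (minus (sin (2 * a * (PI / 2)) / (2 * a)) (sin (2 * a * 0) / (2 * a)))).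
  { apply (is_RInt_derive (fun t => sin (2 * a * t) / (2 * a))); intros t _.
    - auto_derive; [trivial | simpl; field; lra].
    - apply (ex_derive_continuous (fun t => cos (2 * a * t) * cos t ^ (2 * 0))).
      auto_derive; trivial. }
  apply (@is_RInt_unique R_CompleteNormedModule) in H; unfold cosInt; rewrite H.
  unfold minus, plus, opp; simpl.
  rewrite Rmult_0_r, sin_0; replace (2 * a * (PI / 2)) with (PI * a) by field.
  field; lra.
Qed.

Lemma cosInt_zero_zero : cosInt 0 0 = PI / 2.
Proof.
  unfold cosInt.
  rewrite (RInt_ext _ (fun _ => 1)).
  - rewrite RInt_const; unfold scal; simpl; unfold mult; simpl; ring.
  - intros t _; rewrite Rmult_0_r, Rmult_0_l, cos_0; simpl; ring.
Qed.

Lemma cosInt_zero_pos (m : nat) : 0 < cosInt 0 m.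
Proof.
  pose proof PI_RGT_0.
  induction m as [|m IH]; [rewrite cosInt_zero_zero; lra|].
  pose proof (cosInt_S 0 m); pose proof (pos_INR m).
  assert (0 < (INR m + 1) * (2 * INR m + 1)) by nra.
  assert (0 < 2 * ((INR m + 1) ^ 2 - 0 ^ 2)) by nra.
  nra.
Qed.

(** The recursions of the coefficients and of the cosine integrals cancel, so
    this product is a finite form of Euler's product for [sin (PI * a)]. *)
Lemma ellCoeff_cosInt (a : R) (m : nat) :
  0 < a < 1 ->
  (a + INR m) * ellCoeff a m * cosInt a m * PI = cosInt 0 m * sin (PI * a).
Proof.
  intros ha; induction m as [|m IH].
  - rewrite cosInt_zero_zero, <- cosInt_0 by lra.
    unfold ellCoeff; simpl; field.
  - pose proof (cosInt_S 0 m) as H0; pose proof (cosInt_S a m) as H.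
    pose proof (ellCoeff_S a m) as HA; pose proof (pos_INR m) as hm.
    rewrite S_INR in *; set (x := INR m) in *.
    apply Rmult_eq_reg_l with (2 * (x + 1) ^ 2 * (x + 1 - a)); [|nra].
    transitivity ((a + x + 1) * ((x + 1) ^ 2 * ellCoeff a (S m)) *
                  (2 * (x + 1 - a) * cosInt a (S m)) * PI); [ring|].
    rewrite HA.
    transitivity ((a + x) * ellCoeff a m * PI * (x + 1 - a) *
                  (2 * ((x + 1) ^ 2 - a ^ 2) * cosInt a (S m))); [ring|].
    rewrite <- H.
    transitivity ((x + 1 - a) * (x + 1) * (2 * x + 1) *
                  ((a + x) * ellCoeff a m * cosInt a m * PI)); [ring|].
    rewrite IH.
    transitivity ((x + 1 - a) * sin (PI * a) * ((x + 1) * (2 * x + 1) * cosInt 0 m)); [ring|].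
    rewrite H0; ring.
Qed.

(** The chord of the cosine between [0] and [t] lies below its graph: the
    difference vanishes at [t = 0] and has the derivative
    [l (sin t - sin (l t)) >= 0]. *)
Lemma cos_concave_chord (l t : R) :
  0 <= l <= 1 -> 0 <= t <= PI / 2 -> 1 - l + l * cos t <= cos (l * t).
Proof.
  intros hl ht.
  destruct (MVT_gen (fun s => cos (l * s) - l * cos s) 0 t
              (fun s => l * (sin s - sin (l * s)))) as [s [hs Hs]].
  - intros s _; auto_derive; [trivial | ring].
  - intros s _; apply continuity_pt_filterlim.
    apply (ex_derive_continuous (fun s => cos (l * s) - l * cos s)); auto_derive; trivial.
  - rewrite Rmin_left, Rmax_right in hs by lra.
    rewrite Rmult_0_r, cos_0 in Hs.
    assert (sin (l * s) <= sin s) by (apply sin_incr_1; nra).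
    assert (0 <= l * (sin s - sin (l * s)) * (t - 0))
      by (repeat apply Rmult_le_pos; lra).
    lra.
Qed.

(** At [a = 1/2] this is [cos t ^ 2 <= cos t]; concavity interpolates between
    this case and the trivial one [a = 0]. *)
Lemma cos_double_ge (a t : R) :
  0 <= a <= 1 / 2 -> 0 <= t <= PI / 2 ->
  1 - 2 * a + 2 * a * cos t ^ 2 <= cos (2 * a * t).
Proof.
  intros ha ht.
  pose proof (cos_concave_chord (2 * a) t ltac:(lra) ht).
  assert (0 <= cos t) by (apply cos_ge_0; lra).
  pose proof (COS_bound t).
  assert (cos t ^ 2 <= cos t) by nra.
  nra.
Qed.

(** The pointwise bound is a combination of even powers of the cosine, so its
    integral stays within the family [cosInt 0]. *)
Lemma cosInt_ge (a : R) (m : nat) :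
  0 <= a <= 1 / 2 ->
  (1 - 2 * a) * cosInt 0 m + 2 * a * cosInt 0 (S m) <= cosInt a m.
Proof.
  intros ha; pose proof PI_RGT_0.
  apply (is_RInt_le
    (fun t => plus (scal (1 - 2 * a) (cos (2 * 0 * t) * cos t ^ (2 * m)))
                   (scal (2 * a) (cos (2 * 0 * t) * cos t ^ (2 * S m))))
    (fun t => cos (2 * a * t) * cos t ^ (2 * m)) 0 (PI / 2)); [lra | | |].
  - apply (@is_RInt_plus R_NormedModule); apply (@is_RInt_scal R_NormedModule);
      apply (@RInt_correct R_CompleteNormedModule), ex_RInt_cosInt.
  - apply (@RInt_correct R_CompleteNormedModule), ex_RInt_cosInt.
  - intros t ht; unfold plus, scal; simpl; unfold mult; simpl.
    pose proof (cos_double_ge a t ha ltac:(lra)) as H1.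
    rewrite Rmult_0_r, Rmult_0_l, cos_0.
    replace (m + S (m + 0))%nat with (S (m + (m + 0))) by lia.
    set (P := cos t ^ (m + (m + 0))).
    assert (0 <= P) by (apply pow_le, cos_ge_0; lra).
    replace (cos t * cos t ^ S (m + (m + 0))) with (cos t ^ 2 * P) by (unfold P; simpl; ring).
    nra.
Qed.

(** As [cosInt 0 (S n) / cosInt 0 n = (2 n + 1) / (2 n + 2)], the lower bound of
    [cosInt a n] is [cosInt 0 n] times [(n + 1 - a) / (n + 1)].  In the product
    identity this is exactly the factor leading from [(a + n) A_n] to
    [(n + 1) A_(n+1)]. *)
Lemma scaled_ellCoeff_le (a : R) (n : nat) :
  0 < a <= 1 / 2 -> INR (S n) * ellCoeff a (S n) <= sin (PI * a) / PI.
Proof.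
  intros ha; pose proof PI_RGT_0 as hPI; pose proof (pos_INR n) as hn.
  pose proof (ellCoeff_cosInt a n ltac:(lra)) as He.
  pose proof (cosInt_ge a n ltac:(lra)) as Hg.
  pose proof (cosInt_S 0 n) as H0; pose proof (cosInt_zero_pos n) as hJ.
  pose proof (ellCoeff_S a n) as HA; pose proof (ellCoeff_pos a n ltac:(lra)) as hA.
  rewrite S_INR in *; set (x := INR n) in *.
  set (J := cosInt 0 n) in *; set (J' := cosInt 0 (S n)) in *.
  assert (HJ : 2 * J' = J * (2 * x + 1) / (x + 1)).
  { apply Rmult_eq_reg_l with ((x + 1) ^ 2); [|nra].
    transitivity ((x + 1) * (2 * x + 1) * J); [lra | field; lra]. }
  assert (Hge : J * ((x + 1 - a) / (x + 1)) <= cosInt a n).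
  { replace (J * ((x + 1 - a) / (x + 1))) with ((1 - 2 * a) * J + a * (2 * J'))
      by (rewrite HJ; field; lra).
    lra. }
  apply Rmult_le_reg_r with (PI * J); [nra|].
  replace (sin (PI * a) / PI * (PI * J)) with (J * sin (PI * a)) by (field; lra).
  rewrite <- He.
  replace ((x + 1) * ellCoeff a (S n))
    with ((a + x) * ellCoeff a n * ((x + 1 - a) / (x + 1))).
  - replace ((a + x) * ellCoeff a n * ((x + 1 - a) / (x + 1)) * (PI * J))
      with (((a + x) * ellCoeff a n * PI) * (J * ((x + 1 - a) / (x + 1)))) by (field; lra).
    replace ((a + x) * ellCoeff a n * cosInt a n * PI)
      with (((a + x) * ellCoeff a n * PI) * cosInt a n) by ring.
    apply Rmult_le_compat_l; [|exact Hge].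
    apply Rmult_le_pos; [apply Rmult_le_pos|]; lra.
  - apply Rmult_eq_reg_l with (x + 1); [|lra].
    transitivity ((a + x) * (1 - a + x) * ellCoeff a n); [field; lra | rewrite <- HA; ring].
Qed.

Lemma scaled_ellCoeff_lt_sin (a : R) (n : nat) :
  0 < a <= 1 / 2 -> INR (S n) * ellCoeff a (S n) < sin (PI * a) / PI.
Proof.
  intros ha; apply Rlt_le_trans with (INR (S (S n)) * ellCoeff a (S (S n))).
  - apply scaled_ellCoeff_S_lt; lra.
  - now apply scaled_ellCoeff_le.
Qed.

(** * Logarithmic bounds of the complete elliptic integral *)

Lemma ellCoeff_lt_logCoeff (a : R) (n : nat) :
  0 < a <= 1 / 2 -> ellCoeff a (S n) < logCoeff (sin (PI * a) / PI) (S n).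
Proof.
  intros ha; unfold logCoeff; assert (0 < INR (S n)) by (apply lt_0_INR; lia).
  apply Rmult_lt_reg_l with (INR (S n)); [assumption|].
  replace (INR (S n) * (sin (PI * a) / PI / INR (S n))) with (sin (PI * a) / PI)
    by (field; split; [pose proof PI_RGT_0|]; lra).
  now apply scaled_ellCoeff_lt_sin.
Qed.

Lemma ellCoeff_0 (a : R) : ellCoeff a 0 = 1.
Proof. unfold ellCoeff; simpl; field. Qed.

Lemma ellCoeff_le_logCoeff (a x : R) (n : nat) :
  0 < a <= 1 / 2 -> 0 < x ->
  0 <= ellCoeff a n * x ^ n <= logCoeff (sin (PI * a) / PI) n * x ^ n.
Proof.
  intros ha hx; assert (0 < x ^ n) by now apply pow_lt.
  assert (0 < ellCoeff a n) by (apply ellCoeff_pos; lra).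
  split; [nra|].
  apply Rmult_le_compat_r; [lra|].
  destruct n as [|n]; [rewrite ellCoeff_0; simpl; lra|].
  now left; apply ellCoeff_lt_logCoeff.
Qed.

Lemma hyp2F1_lt_log (a x : R) :
  0 < a <= 1 / 2 -> 0 < x < 1 ->
  hyp2F1 a (1 - a) 1 x < 1 - sin (PI * a) / PI * ln (1 - x).
Proof.
  intros ha hx.
  pose proof (is_series_logCoeff (sin (PI * a) / PI) x hx) as Hs.
  rewrite <- (is_series_unique _ _ Hs).
  apply (Series_lt (fun n => ellCoeff a n * x ^ n)) with 1%nat.
  - intros n; apply ellCoeff_le_logCoeff; lra.
  - apply Rmult_lt_compat_r; [apply pow_lt; lra | now apply ellCoeff_lt_logCoeff].
  - eexists; exact Hs.
Qed.

Lemma log_lt_hyp2F1 (a x : R) :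
  0 < a <= 1 / 2 -> 0 < x < 1 ->
  1 - a * (1 - a) * ln (1 - x) < hyp2F1 a (1 - a) 1 x.
Proof.
  intros ha hx.
  rewrite <- (is_series_unique _ _ (is_series_logCoeff (a * (1 - a)) x hx)).
  assert (Hlog : forall n, a * (1 - a) = INR (S n) * logCoeff (a * (1 - a)) (S n))
    by (intros n; unfold logCoeff; field; apply not_0_INR; lia).
  assert (hS : forall n, 0 < INR (S n)) by (intros n; apply lt_0_INR; lia).
  assert (hc : 0 < a * (1 - a)) by nra.
  (* both series agree up to degree one *)
  apply (Series_lt _ (fun n => ellCoeff a n * x ^ n)) with 2%nat.
  - intros n; assert (0 < x ^ n) by (apply pow_lt; lra).
    enough (0 <= logCoeff (a * (1 - a)) n <= ellCoeff a n)
      by (split; [apply Rmult_le_pos | apply Rmult_le_compat_r]; lra).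
    destruct n as [|n]; [rewrite ellCoeff_0; simpl; lra|].
    pose proof (scaled_ellCoeff_ge a n ltac:(lra)) as Hge.
    split; apply Rmult_le_reg_l with (INR (S n)); try apply hS; rewrite <- Hlog; lra.
  - apply Rmult_lt_compat_r; [apply pow_lt; lra|].
    apply Rmult_lt_reg_l with (INR 2); [apply hS|]; rewrite <- Hlog.
    pose proof (scaled_ellCoeff_S_lt a 0 ltac:(lra)) as H.
    rewrite ellCoeff_one in H; simpl (INR 1) in H; lra.
  - (* the upper logarithmic bound also provides the convergence *)
    apply (@ex_series_le R_AbsRing R_CompleteNormedModule _
             (fun n => logCoeff (sin (PI * a) / PI) n * x ^ n)).
    + intros n; unfold norm; simpl; unfold abs; simpl.
      rewrite Rabs_pos_eq; apply ellCoeff_le_logCoeff; lra.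
    + eexists; now apply is_series_logCoeff.
Qed.

(** * The generalized inverse hyperbolic tangent *)

(** With [p = 2 q] and [x = t ^ 2] this is Bernoulli's inequality
    [q (1 / x - 1) <= x ^ (-q) - 1], obtained from two uses of [1 + u <= exp u]. *)
Lemma inv_one_minus_Rpower_le (p t : R) :
  2 <= p -> 0 < t < 1 ->
  / (1 - Rpower t p) <= 1 + 2 / p * (t ^ 2 / (1 - t ^ 2)).
Proof.
  intros hp ht.
  assert (hl : ln t < 0) by (rewrite <- ln_1; apply ln_increasing; lra).
  assert (hy : Rpower t p < 1).
  { unfold Rpower; rewrite <- exp_0; apply exp_increasing; nra. }
  assert (hy0 : 0 < Rpower t p) by apply exp_pos.
  set (y := Rpower t p) in *; set (x := t ^ 2).
  assert (hx : 0 < x < 1) by (unfold x; nra).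
  set (q := p / 2); assert (hq : 1 <= q) by (unfold q; lra).
  (* [x = exp (- s)] and [y = exp (- q s)] *)
  set (s := - (2 * ln t)).
  assert (Hx : x = exp (- s)).
  { unfold x, s; rewrite Ropp_involutive.
    replace (2 * ln t) with (ln t + ln t) by ring.
    rewrite exp_plus, exp_ln by lra; ring. }
  assert (Hy : y * exp ((q - 1) * s) = x).
  { unfold y, Rpower; rewrite <- exp_plus, Hx; f_equal; unfold s, q; field. }
  pose proof (exp_ineq1_le (- s)) as H1; rewrite <- Hx in H1.
  pose proof (exp_ineq1_le ((q - 1) * s)) as H2.
  assert (H3 : q - (q - 1) * x <= exp ((q - 1) * s)) by nra.
  assert (H4 : y * (q - (q - 1) * x) <= x)
    by (apply Rle_trans with (y * exp ((q - 1) * s));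
        [apply Rmult_le_compat_l; lra | lra]).
  replace (2 / p) with (/ q) by (unfold q; field; lra).
  apply Rmult_le_reg_r with ((1 - y) * (q * (1 - x))).
  { apply Rmult_lt_0_compat; [lra | nra]. }
  replace (/ (1 - y) * ((1 - y) * (q * (1 - x)))) with (q * (1 - x)) by (field; lra).
  replace ((1 + / q * (x / (1 - x))) * ((1 - y) * (q * (1 - x))))
    with ((1 - y) * (q * (1 - x) + x)) by (field; lra).
  nra.
Qed.

(** Continuous extension of the integrand to [t = 0].  As [Rpower 0 p = 1], the
    integrand itself is discontinuous there, and its integrability is deduced
    from that of the extension. *)
Definition artanhIntegrand (p t : R) : R :=
  / (1 - if Rle_dec t 0 then 0 else Rpower t p).

Lemma continuous_artanhIntegrand (p t : R) :
  2 <= p -> 0 <= t < 1 -> continuous (artanhIntegrand p) t.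
Proof.
  intros hp ht.
  set (h := fun t => if Rle_dec t 0 then 0 else Rpower t p).
  assert (Hpow : forall u, 0 < u < 1 -> 0 < Rpower u p <= u).
  { intros u hu; split; [apply exp_pos|].
    assert (ln u < 0) by (rewrite <- ln_1; apply ln_increasing; lra).
    rewrite <- (exp_ln u) at 2 by lra.
    unfold Rpower; left; apply exp_increasing; nra. }
  assert (Hh : continuous h t).
  { destruct (Req_dec t 0) as [-> | hne].
    - apply filterlim_locally; intros eps.
      assert (hd : 0 < Rmin 1 eps) by (apply Rmin_glb_lt; [lra | apply cond_pos]).
      exists (mkposreal _ hd); intros u hu.
      unfold ball in *; simpl in *; unfold AbsRing_ball, abs, minus, plus, opp in *;
        simpl in *.
      pose proof (Rmin_l 1 eps); pose proof (Rmin_r 1 eps); pose proof (cond_pos eps).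
      unfold h; destruct (Rle_dec 0 0) as [_ | n]; [|lra].
      rewrite Ropp_0, Rplus_0_r in *; apply Rabs_def2 in hu.
      destruct (Rle_dec u 0); [rewrite Rabs_R0; lra|].
      pose proof (Hpow u ltac:(lra)); rewrite Rabs_pos_eq; lra.
    - apply continuous_ext_loc with (fun u => Rpower u p).
      + exists (mkposreal t ltac:(lra)); intros u hu.
        unfold ball in hu; simpl in hu; unfold AbsRing_ball, abs, minus, plus, opp in hu;
          simpl in hu; apply Rabs_def2 in hu.
        unfold h; destruct (Rle_dec u 0); [lra | reflexivity].
      + apply (ex_derive_continuous (fun u => Rpower u p)).
        unfold Rpower; auto_derive; lra. }
  apply (continuous_comp h (fun y => / (1 - y))); [exact Hh|].
  apply (ex_derive_continuous (fun y => / (1 - y))); auto_derive.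
  unfold h; destruct (Rle_dec t 0); [lra|].
  pose proof (Hpow t ltac:(lra)); lra.
Qed.

Lemma ex_RInt_artanh_p (p r : R) :
  2 <= p -> 0 < r < 1 -> ex_RInt (fun t => / (1 - Rpower t p)) 0 r.
Proof.
  intros hp hr; apply ex_RInt_ext with (artanhIntegrand p).
  - rewrite Rmin_left by lra; intros t ht; unfold artanhIntegrand.
    destruct (Rle_dec t 0); [lra | reflexivity].
  - apply (@ex_RInt_continuous R_CompleteNormedModule).
    rewrite Rmin_left, Rmax_right by lra; intros t ht.
    apply continuous_artanhIntegrand; lra.
Qed.

(** The right-hand side has the derivative
    [1 - 2 k ln (1 - t ^ 2) + 4 k t ^ 2 / (1 - t ^ 2)], and [2 / p <= 4 k]
    because [p <= 2 (p - 1)]. *)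
Lemma artanh_p_le (p r : R) :
  2 <= p -> 0 < r < 1 ->
  artanh_p p r <= r * (1 - 2 * ((p - 1) / p ^ 2) * ln (1 - r ^ 2)).
Proof.
  intros hp hr; set (k := (p - 1) / p ^ 2).
  assert (hk : 2 / p <= 4 * k).
  { apply Rminus_le_0; unfold k.
    replace (4 * ((p - 1) / p ^ 2) - 2 / p) with (2 * (p - 2) / p ^ 2) by (field; lra).
    apply Rdiv_le_0_compat; [lra | nra]. }
  assert (hk0 : 0 < k).
  { unfold k; apply Rdiv_lt_0_compat; [lra | nra]. }
  pose (Phi := fun t => t * (1 - 2 * k * ln (1 - t ^ 2))).
  pose (phi := fun t => 1 - 2 * k * ln (1 - t ^ 2) + 4 * k * (t ^ 2 / (1 - t ^ 2))).
  assert (HPhi : is_RInt phi 0 r (minus (Phi r) (Phi 0))).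
  { apply (is_RInt_derive Phi phi); rewrite Rmin_left, Rmax_right by lra; intros t ht.
    - assert (t * (t * 1) < 1) by nra.
      unfold Phi, phi; auto_derive; [lra|].
      replace (1 - t ^ 2) with (1 + - (t * (t * 1))) by ring; field; lra.
    - assert (t * (t * 1) < 1) by nra.
      apply (ex_derive_continuous phi); unfold phi; auto_derive.
      repeat split; lra. }
  replace (r * (1 - 2 * k * ln (1 - r ^ 2))) with (minus (Phi r) (Phi 0))
    by (unfold Phi, minus, plus, opp; simpl; ring).
  apply (is_RInt_le (fun t => / (1 - Rpower t p)) phi 0 r); [lra | | exact HPhi |].
  - apply (@RInt_correct R_CompleteNormedModule), ex_RInt_artanh_p; assumption.
  - intros t ht; eapply Rle_trans; [apply inv_one_minus_Rpower_le; lra|].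
    assert (hx : 0 < t ^ 2 < 1) by nra; unfold phi.
    assert (ln (1 - t ^ 2) <= 0).
    { rewrite <- ln_1; apply Rlt_le, ln_increasing; lra. }
    assert (0 <= t ^ 2 / (1 - t ^ 2)) by (apply Rdiv_le_0_compat; lra).
    nra.
Qed.

(** * The chain of inequalities *)

Theorem theorem1p7 (p r a : R) (hp : 2 <= p) (hr : 0 < r < 1) (ha : a = 1 / p) :
  PI / 2 * sqrt (artanh_p p r / r)
    < PI / 2 * (1 - (p - 1) / p ^ 2 * ln (1 - r ^ 2))
  /\ PI / 2 * (1 - (p - 1) / p ^ 2 * ln (1 - r ^ 2)) < ellK a r
  /\ ellK a r < PI / 2 * (1 - 2 / (p * pi_p p) * ln (1 - r ^ 2)).
Proof.
  pose proof PI_RGT_0 as hPI.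
  assert (hx : 0 < r ^ 2 < 1) by nra.
  assert (ha' : 0 < a <= 1 / 2).
  { rewrite ha; split; [apply Rdiv_lt_0_compat; lra|].
    apply Rmult_le_compat_l; [lra | apply Rinv_le_contravar; lra]. }
  split; [|split].
  - apply Rmult_lt_compat_l; [lra|].
    pose proof (artanh_p_le p r hp hr) as H.
    set (k := (p - 1) / p ^ 2) in *.
    assert (hk : 0 < k) by (unfold k; apply Rdiv_lt_0_compat; nra).
    assert (hl : ln (1 - r ^ 2) < 0) by (rewrite <- ln_1; apply ln_increasing; lra).
    set (l := ln (1 - r ^ 2)) in *.
    assert (0 < - (k * l)) by nra.
    rewrite <- (sqrt_pow2 (1 - k * l)) by lra.
    apply Rle_lt_trans with (sqrt (1 - 2 * k * l)).
    + apply sqrt_le_1_alt.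
      apply Rmult_le_reg_r with r; [lra|].
      replace (artanh_p p r / r * r) with (artanh_p p r) by (field; lra); lra.
    + apply sqrt_lt_1_alt; split; nra.
  - unfold ellK; apply Rmult_lt_compat_l; [lra|].
    replace ((p - 1) / p ^ 2) with (a * (1 - a)) by (rewrite ha; field; lra).
    now apply log_lt_hyp2F1.
  - unfold ellK; apply Rmult_lt_compat_l; [lra|].
    replace (2 / (p * pi_p p)) with (sin (PI * a) / PI).
    + now apply hyp2F1_lt_log.
    + assert (0 < sin (PI / p)).
      { replace (PI / p) with (PI * a) by (rewrite ha; field; lra).
        apply sin_gt_0; nra. }
      unfold pi_p; replace (PI * a) with (PI / p) by (rewrite ha; field; lra).
      field; repeat split; lra.
Qed.
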